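(* Let $X$ be any continuum. For any pair $(n_0,m_0)\in\mathcal W$, the following statements are equivalent. 1. $X$ does not have the fixed point property. 2. There is an inverse sequence $\{P_\ell,f_\ell\}_{\ell=1}^{\infty}$ of connected polyhedra $P_\ell$ and continuous surjections $f_\ell:P_{\ell+1}\to P_\ell$ such that $\varprojlim\{P_\ell,f_\ell\}_{\ell=1}^{\infty}$ is homeomorphic to $X$, and there is a continuous function $g:\varprojlim\{P_\ell,f_\ell\}_{\ell=1}^{\infty}\to\varprojlim\{P_\ell,f_\ell\}_{\ell=1}^{\infty}$ such that $f_{n_0,m_0}(x)\notin T_{n_0,m_0}(g)(x)$ for each $x\in P_{m_0}$.
   Context: A continuum is a non-empty connected compact metric space (a single point is allowed). A space has the fixed point property if every continuous function from it to itself has a fixed point. Polyhedra here are compact (homeomorphic to the underlying space of a finite simplicial complex). $\mathcal W=\{(n,m)\in\mathbb N\times\mathbb N \mid n\le m\}$, where $\mathbb N$ is the set of positive integers. For compact metric spaces $P_\ell$ and continuous maps $f_\ell:P_{\ell+1}\to P_\ell$, the inverse limit $\varprojlim\{P_\ell,f_\ell\}_{\ell=1}^\infty$ is the subspace of $\prod_{\ell=1}^\infty P_\ell$ of all $(x_1,x_2,\ldots)$ with $x_\ell=f_\ell(x_{\ell+1})$ for all $\ell\ge1$, and $p_n$ is its $n$-th coordinate projection onto $P_n$. For $n<m$, $f_{n,m}=f_n\circ\cdots\circ f_{m-1}:P_m\to P_n$, and $f_{n,n}$ is the identity on $P_n$. For a function $g$ from $\varprojlim\{P_\ell,f_\ell\}_{\ell=1}^\infty$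 to itself, $T_{n,m}(g)(x)=p_n(g(p_m^{-1}(x)))\subseteq P_n$ for $x\in P_m$. *)

(* Defs.v *)
From HB Require Import structures.
From mathcomp Require Import all_boot all_order all_algebra finmap.
From mathcomp Require Import all_classical all_reals all_analysis.
Import Order.TTheory GRing.Theory Num.Theory.
Import numFieldNormedType.Exports.

Set Implicit Arguments.
Unset Strict Implicit.
Unset Printing Implicit Defensive.

Local Open Scope classical_set_scope.
Local Open Scope ring_scope.

Definition homeomorphic (A B : topologicalType) : Prop :=
  exists (f : A -> B) (g : B -> A),
    [/\ continuous f, continuous g, cancel f g & cancel g f].

Definition continuum (R : realType) (X : metricType R) : Prop :=
  [/\ [set: X] !=set0, connected [set: X] & compact [set: X]].

Definition fixed_point_property (T : topologicalType) : Prop :=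
  forall f : T -> T, continuous f -> exists x, f x = x.

(** A simplex of R^N is given by the finite set of its vertices; its faces are
    the nonempty subsets of that set. *)
Section SimplicialComplex.
Context {R : realType} {N : nat}.
Implicit Types (s t u : {fset 'rV[R]_N}) (K : {fset {fset 'rV[R]_N}}).

Definition affinely_independent s : Prop :=
  forall a : 'rV[R]_N -> R,
    \sum_(v <- s) a v = 0 -> \sum_(v <- s) a v *: v = 0 ->
    forall v, v \in s -> a v = 0.

Definition convex_hull s : set 'rV[R]_N :=
  [set x | exists a : 'rV[R]_N -> R,
    [/\ forall v, v \in s -> 0 <= a v,
        \sum_(v <- s) a v = 1 &
        x = \sum_(v <- s) a v *: v]].

Definition face u s : Prop := u != fset0 /\ (u `<=` s)%fset.

Definition simplicial_complex K : Prop :=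
  [/\ forall s, s \in K -> s != fset0 /\ affinely_independent s,
      forall s u, s \in K -> face u s -> u \in K &
      forall s t, s \in K -> t \in K ->
        convex_hull s `&` convex_hull t !=set0 ->
        exists u, [/\ face u s, face u t &
          convex_hull s `&` convex_hull t = convex_hull u]].

Definition underlying_space K : set 'rV[R]_N :=
  [set x | exists2 s, s \in K & convex_hull s x].

End SimplicialComplex.

(** The underlying space carries the subspace topology of R^N, through the
    topology of [set_type]. *)
Definition polyhedron (R : realType) (P : topologicalType) : Prop :=
  exists (N : nat) (K : {fset {fset 'rV[R]_N}}),
    simplicial_complex K /\ homeomorphic P (underlying_space K).

(** Sequences are indexed from 0: [P l] and [f l] stand for the terms usually
    written P_(l+1) and f_(l+1), and a pair n <= m of naturals stands for the
    pair (n+1, m+1) of positive integers. *)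
Section InverseSequence.
Variables (P : nat -> topologicalType) (f : forall l, P l.+1 -> P l).

Definition inverse_limit : set (prod_topology P) :=
  [set x : prod_topology P | forall l, x l = f (x l.+1)].

Definition lim_proj (n : nat) (x : inverse_limit) : P n := set_val x n.

Fixpoint bonding_add (n k : nat) : P (k + n)%N -> P n :=
  match k with
  | 0 => id
  | k'.+1 => fun x => bonding_add (f x)
  end.

(** f_(n,m); the index of [P m] is transported along m = (m - n) + n. *)
Definition bonding (n m : nat) (le_nm : (n <= m)%N) (x : P m) : P n :=
  bonding_add (ecast i (P i) (esym (subnK le_nm)) x).

Lemma bonding_refl n (le_nn : (n <= n)%N) (x : P n) : bonding le_nn x = x.
Proof.
rewrite /bonding; move: (esym _); rewrite subnn => e.
by rewrite (eq_irrelevance e erefl).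
Qed.

Lemma bondingS n m (le_nm : (n <= m)%N) (le_nSm : (n <= m.+1)%N)
  (x : P m.+1) : bonding le_nSm x = bonding le_nm (f x).
Proof.
rewrite /bonding; move: (subnK le_nSm) (subnK le_nm).
rewrite subSn //; move: (m - n)%N => k e1 e2; move: e1 x.
by case: m / e2 le_nm le_nSm => _ _ e1 x; rewrite (eq_irrelevance e1 erefl).
Qed.

Definition T_map (n m : nat) (g : inverse_limit -> inverse_limit) (x : P m) :
  set (P n) := lim_proj n @` (g @` (lim_proj m @^-1` [set x])).

End InverseSequence.

Arguments T_map {P f} n m g x.

(* Main.v *)
Require Import Defs.
From HB Require Import structures.
From mathcomp Require Import all_boot all_order all_algebra finmap.
From mathcomp Require Import all_classical all_reals all_analysis.
From mathcomp Require Import ring lra.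
Import Order.TTheory GRing.Theory Num.Theory.
Import numFieldNormedType.Exports.
Local Open Scope classical_set_scope.
Local Open Scope ring_scope.

Set Implicit Arguments.
Unset Strict Implicit.
Unset Printing Implicit Defensive.

(** A fixed-point-free map [F] of [X] moves every point by at least some [e > 0],
    so it suffices to write [X] as the limit of polyhedra with surjective bonding
    maps such that points with equal image in some polyhedron are [e]-close;
    conversely a fixed point of [g] violates the condition on [T_map].

    The expansion is Freudenthal's.  Given finitely many balls [B_i] covering [X],
    take a simplicial complex [L] on their indices, with as few simplices as
    possible, that receives a continuous map [phi : X -> |L|] such that
    [phi_i x <> 0] implies [x] in [B_i].  By minimality every map [X -> |L|] with
    this property is onto: a point missed in a maximal open simplex would allow
    pushing the map off that simplex.  For a much finer cover with data
    [L', phi', B'_k], extend the map sending the vertex [k] to the image under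
    [phi] of the center of [B'_k] linearly, and decrease all coordinates by a
    small [delta] (cutting off at [0] and normalizing).  The resulting map
    [f : |L'| -> |L|] satisfies [supp (f (phi' x)) <= supp (phi x)], so
    [f \o phi'] is again subordinate to [B], whence [f] is onto; moreover
    [f \o phi'] is as close to [phi] as we please.

    For a thread [y] of the limit, any choice of [x_l] with [phi_l x_l = y_l] is
    Cauchy, by the condition on supports, and [y |-> lim x_l] is the
    homeomorphism onto [X]; closeness of [f \o phi'] to [phi] gives its
    injectivity. *)

(** * Geometric realizations in a standard simplex *)

Definition abstract_complex (N : nat) (L : {set {set 'I_N}}) : Prop :=
  (forall s, s \in L -> s != finset.set0) /\
  forall s t : {set 'I_N}, s \in L -> t \subset s -> t != finset.set0 -> t \in L.

Section Realization.
Context {R : realType} {N : nat}.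
Implicit Types (y : 'rV[R]_N) (s t : {set 'I_N}) (L : {set {set 'I_N}}).

Definition supp y : {set 'I_N} := [set i | y ord0 i != 0]%SET.

Definition stdsimplex y : Prop :=
  (forall i, 0 <= y ord0 i) /\ \sum_i y ord0 i = 1.

Definition realization L : set 'rV[R]_N :=
  [set y | stdsimplex y /\ supp y \in L].

Definition vertex (i : 'I_N) : 'rV[R]_N := delta_mx ord0 i.

Definition vertices s : {fset 'rV[R]_N} := [fset vertex i | i in s]%fset.

Lemma vertexE i j : vertex i ord0 j = (i == j)%:R.
Proof. by rewrite mxE eqxx eq_sym. Qed.

Lemma vertex_inj : injective vertex.
Proof.
move=> i j /matrixP/(_ ord0 i); rewrite !vertexE eqxx.
by case: eqVneq => // _ /eqP; rewrite oner_eq0.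
Qed.

Lemma big_vertices (V : zmodType) s (F : 'rV[R]_N -> V) :
  \sum_(v <- vertices s) F v = \sum_(i in s) F (vertex i).
Proof.
rewrite (@big_imfset _ _ _ _ _ _ vertex (mem s)) /=; last first.
  by move=> i j _ _; exact: vertex_inj.
by rewrite big_enum.
Qed.

Lemma in_vertices s i : (vertex i \in vertices s) = (i \in s).
Proof.
apply/imfsetP/idP => [[j /= js /vertex_inj ->//]|is_]; by exists i.
Qed.

Lemma sum_vertices s (a : 'I_N -> R) i :
  (\sum_(j in s) a j *: vertex j) ord0 i = if i \in s then a i else 0.
Proof.
rewrite summxE.
under eq_bigr do rewrite mxE vertexE mulr_natr mulrb.
case: ifP => is_; last first.
  by rewrite big1// => j js; case: eqVneq => // ji; rewrite -ji js in is_.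
rewrite (bigD1 i)//= eqxx big1 ?addr0// => j /andP[_ /negbTE ->//].
Qed.

(** The vertices are unit vectors, so the barycentric coordinates of a point are its coordinates. *)
Lemma convex_hull_vertices s :
  convex_hull (vertices s) = [set y | stdsimplex y /\ supp y \subset s].
Proof.
apply/seteqP; split => [y [a [a0 a1 ->]]|y [[y0 y1] ys]] /=.
  rewrite big_vertices in a1; rewrite big_vertices.
  have E i := sum_vertices s (fun j => a (vertex j)) i.
  split; first split => [i|].
  - by rewrite E; case: ifP => // is_; apply: a0; rewrite in_vertices.
  - by under eq_bigr do rewrite E; rewrite -big_mkcond.
  - by apply/fintype.subsetP => i; rewrite inE E; case: ifP => //; rewrite eqxx.
have yn i : i \notin s -> y ord0 i = 0.
  move=> is_; apply/eqP; apply: contraNT is_ => yi.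
  by move/fintype.subsetP: ys; apply; rewrite inE.
(* Weights must be defined on all vectors. The scalar product with [y] takes the value [y_i] at
   [vertex i]. *)
pose a (v : 'rV[R]_N) := \sum_j y ord0 j * v ord0 j.
have aE i : a (vertex i) = y ord0 i.
  rewrite /a (bigD1 i)//= vertexE eqxx mulr1 big1 ?addr0// => j ji.
  by rewrite vertexE eq_sym (negbTE ji) mulr0.
exists a; split.
- by move=> v /imfsetP[i /= _ ->]; rewrite aE.
- rewrite big_vertices; under eq_bigr do rewrite aE.
  by rewrite big_mkcond -[RHS]y1; apply: eq_bigr => i _; case: ifPn => // /yn.
- apply/rowP => i; rewrite big_vertices; under eq_bigr do rewrite aE.
  by rewrite sum_vertices; case: ifPn => // /yn.
Qed.

Lemma supp_neq0 y : stdsimplex y -> supp y != finset.set0.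
Proof.
move=> [_ y1]; apply/eqP => y0; move: y1; rewrite big1 => [/eqP|i _].
  by rewrite eq_sym oner_eq0.
have : i \notin supp y by rewrite y0 inE.
by rewrite inE negbK => /eqP.
Qed.

Lemma vertices_neq0 s : (vertices s != fset0) = (s != finset.set0).
Proof.
apply/fset0Pn/set0Pn => [[v /imfsetP[i /= is_ _]]|[i is_]].
  by exists i.
by exists (vertex i); rewrite in_vertices.
Qed.

Lemma vertices_face s t : t \subset s -> t != finset.set0 ->
  face (vertices t) (vertices s).
Proof.
move=> ts t0; split; first by rewrite vertices_neq0.
apply/fsubsetP => v /imfsetP[i /= it ->]; rewrite in_vertices.
by move/fintype.subsetP : ts; exact.
Qed.

Lemma face_vertices u s : face u (vertices s) ->
  exists t : {set 'I_N}, [/\ t \subset s, t != finset.set0 & u = vertices t].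
Proof.
move=> [u0 us]; pose t := [set i | vertex i \in u]%SET.
have tE : u = vertices t.
  apply/fsetP => v; apply/idP/imfsetP => [vu|[i /=]]; last first.
    by rewrite inE => iu ->.
  have /imfsetP[i /= _ vE] := fsubsetP us _ vu.
  by exists i; rewrite //= inE -vE.
exists t; split=> //; last by rewrite -vertices_neq0 -tE.
apply/fintype.subsetP => i; rewrite inE => /(fsubsetP us).
by rewrite in_vertices.
Qed.

Lemma homeomorphic_refl (T : topologicalType) : homeomorphic T T.
Proof. by exists id, id; split=> // x; exact: cvg_id. Qed.

(** Hulls are cut out by support conditions, so those of [s] and [t] meet in the hull of [s :&: t].
    This set is nonempty because it contains the support of any common point. *)
Lemma polyhedron_realization L : abstract_complex L ->
  polyhedron R (realization L).
Proof.
move=> [L0 Ldown].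
pose K : {fset {fset 'rV[R]_N}} := [fset vertices s | s in L]%fset.
exists N, K; split; last first.
  have -> : underlying_space K = realization L; last exact: homeomorphic_refl.
  apply/seteqP; split=> y /=.
    case=> _ /imfsetP[s /= sL ->]; rewrite convex_hull_vertices => -[y1 ys].
    by split=> //; apply: Ldown sL ys _; exact: supp_neq0.
  move=> [y1 yL]; exists (vertices (supp y)).
    by apply/imfsetP; exists (supp y).
  by rewrite convex_hull_vertices.
split.
- move=> _ /imfsetP[s /= sL ->]; split; first by rewrite vertices_neq0 L0.
  move=> a; rewrite !big_vertices => _ /matrixP a0 _ /imfsetP[i /= is_ ->].
  have := a0 ord0 i; rewrite (sum_vertices s (fun j => a (vertex j))).
  by rewrite is_ mxE.
- move=> _ u /imfsetP[s /= sL ->] /face_vertices[t [ts t0 ->]].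
  by apply/imfsetP; exists t => //=; exact: Ldown ts t0.
- move=> _ _ /imfsetP[s /= sL ->] /imfsetP[t /= tL ->].
  rewrite !convex_hull_vertices => -[y [[y1 ys] [_ yt]]].
  have st0 : s :&: t != finset.set0.
    apply: contraNneq (supp_neq0 y1) => st0.
    by rewrite -finset.subset0 -st0 finset.subsetI ys.
  exists (vertices (s :&: t)); split.
  + by apply: vertices_face => //; exact: finset.subsetIl.
  + by apply: vertices_face => //; exact: finset.subsetIr.
  + rewrite convex_hull_vertices; apply/seteqP; split=> z /=.
      by move=> [[z1 zs] [_ zt]]; split=> //; rewrite finset.subsetI zs.
    by rewrite finset.subsetI => -[z1 /andP[]].
Qed.

End Realization.

(** * Maps into a standard simplex *)

Section RealValued.
Context {R : realType} {T : topologicalType}.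
Implicit Types f g : T -> R.

Lemma continuous_subr f g :
  continuous f -> continuous g -> continuous (fun x => f x - g x).
Proof. by move=> fc gc x; apply: cvgB; [exact: fc|exact: gc]. Qed.

Lemma continuous_mulr f g :
  continuous f -> continuous g -> continuous (fun x => f x * g x).
Proof. by move=> fc gc x; apply: cvgM; [exact: fc|exact: gc]. Qed.

Lemma continuous_invr f : (forall x, f x != 0) ->
  continuous f -> continuous (fun x => (f x)^-1).
Proof. by move=> f0 fc x; apply: cvgV => //; exact: fc. Qed.

Lemma continuous_maxr f g :
  continuous f -> continuous g -> continuous (fun x => Num.max (f x) (g x)).
Proof.
move=> fc gc x.
by apply: (@continuous_max _ _ f g); [exact: fc|exact: gc].
Qed.

End RealValued.

Section RowContinuity.
Context {R : realType}.
Implicit Types (T : topologicalType) (N : nat).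

Lemma continuous_row T N (h : T -> 'rV[R]_N) :
  (forall i, continuous (fun x => h x ord0 i)) -> continuous h.
Proof.
move=> hc x A /nbhs_ballP[e /= e0 eA].
have : \forall z \near x, forall i, ball (h x ord0 i) e (h z ord0 i).
  apply: filter_forall => i.
  by have /cvgrPdist_lt/(_ e e0) := hc i x.
by apply: filterS => z hz; apply: eA; split=> // j i; rewrite ord1.
Qed.

Lemma continuous_coord T N (h : T -> 'rV[R]_N) i :
  continuous h -> continuous (fun x => h x ord0 i).
Proof.
move=> hc x.
apply: (@continuous_comp _ _ _ h (fun M : 'rV[R]_N => M ord0 i)); first exact: hc.
exact: coord_continuous.
Qed.

Lemma continuous_sum T I (r : seq I) (F : I -> T -> R) :
  (forall i, continuous (F i)) -> continuous (fun x => \sum_(i <- r) F i x).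
Proof.
move=> Fc; apply: (@continuous_big _ _ (+%R) 0) => // z; exact: add_continuous.
Qed.

Definition normalize N (w : 'rV[R]_N) : 'rV[R]_N :=
  \row_i (w ord0 i / \sum_j w ord0 j).

Lemma continuous_normalize T N (h : T -> 'rV[R]_N) :
  (forall x, \sum_j h x ord0 j != 0) -> continuous h ->
  continuous (fun x => normalize (h x)).
Proof.
move=> h0 hc; apply: continuous_row => i.
under eq_fun do rewrite mxE.
apply: continuous_mulr; first exact: continuous_coord.
apply: continuous_invr => //; apply: continuous_sum => j.
exact: continuous_coord.
Qed.

Section Normalize.
Context {N : nat} (w : 'rV[R]_N).
Hypotheses (w0 : forall i, 0 <= w ord0 i) (w1 : 0 < \sum_j w ord0 j).

Lemma normalize_stdsimplex : stdsimplex (normalize w).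
Proof.
split=> [i|]; first by rewrite mxE divr_ge0// ltW.
under eq_bigr do rewrite mxE.
by rewrite -mulr_suml divff// gt_eqF.
Qed.

Lemma supp_normalize : supp (normalize w) = supp w.
Proof.
apply/setP => i; rewrite !inE mxE mulf_eq0 invr_eq0.
by rewrite (gt_eqF w1) orbF.
Qed.

End Normalize.

Lemma stdsimplex_le1 N (y : 'rV[R]_N) i : stdsimplex y -> y ord0 i <= 1.
Proof.
by move=> [y0 <-]; rewrite (bigD1 i)//= lerDl sumr_ge0.
Qed.

End RowContinuity.

Section Sweep.
Context {R : realType} {N : nat}.
Implicit Types (L : {set {set 'I_N}}) (b z : 'rV[R]_N).

(** If [b] has support [tau], a maximal simplex, then removing from [z] as large
    a multiple of [b] as possible pushes [z <> b] out of the open simplex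
    [tau]. *)
Definition sweep_coef b z : R :=
  \big[Num.min/1]_(i in supp b) (z ord0 i / b ord0 i).

Definition sweep b z : 'rV[R]_N := normalize (z - sweep_coef b z *: b).

Lemma continuous_sweep_coef (T : topologicalType) b (h : T -> 'rV[R]_N) :
  continuous h -> continuous (fun x => sweep_coef b (h x)).
Proof.
move=> hc; rewrite /sweep_coef.
apply: (@continuous_big R _ Num.min 1 (fun i => i \in supp b) _ T _
  (fun i x => h x ord0 i / b ord0 i)) => [z|i _ x].
  exact: min_continuous.
by apply: cvgM; [exact: continuous_coord|exact: cvg_cst].
Qed.

Section SweepLemmas.
Variables b z : 'rV[R]_N.
Hypotheses (bs : stdsimplex b) (zs : stdsimplex z) (zb : z != b).
Let c := sweep_coef b z.
Let w := z - c *: b.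

Let wE i : w ord0 i = z ord0 i - c * b ord0 i.
Proof. by rewrite !mxE. Qed.

Let b_gt0 i : i \in supp b -> 0 < b ord0 i.
Proof. by rewrite inE lt_neqAle eq_sym => ->; rewrite bs.1. Qed.

Let b_eq0 i : i \notin supp b -> b ord0 i = 0.
Proof. by rewrite inE negbK => /eqP. Qed.

Let c_ge0 : 0 <= c.
Proof.
by apply/bigmin_geP; split=> // i _; rewrite divr_ge0 ?bs.1 ?zs.1.
Qed.

Let sweep_ge0 i : 0 <= w ord0 i.
Proof.
rewrite wE; have [ib|/b_eq0 ->] := boolP (i \in supp b); last first.
  by rewrite mulr0 subr0 zs.1.
rewrite subr_ge0 -ler_pdivlMr ?b_gt0//.
have : c <= c by [].
by rewrite {2}/c => /bigmin_geP[_]; apply.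
Qed.

(** If [c] were 1, the nonnegative vector [z - b] would have coordinate sum 0, forcing [z = b]. *)
Let c_lt1 : c < 1.
Proof.
have /bigmin_geP[] : c <= c by [].
rewrite le_eqVlt => /orP[/eqP c1 _|//].
have wsum : \sum_i w ord0 i = 0.
  under eq_bigr do rewrite wE.
  by rewrite sumrB -mulr_sumr bs.2 zs.2 c1 mulr1 subrr.
exfalso; move/negP : zb; apply; apply/eqP/rowP => i.
have /eqP := wsum; rewrite psumr_eq0// => /allP/(_ i).
rewrite mem_index_enum => /(_ isT) /=.
by rewrite wE c1 mul1r subr_eq0 => /eqP.
Qed.

Lemma sweep_sum : 0 < \sum_i w ord0 i.
Proof.
under eq_bigr do rewrite wE.
by rewrite sumrB -mulr_sumr bs.2 zs.2 mulr1 subr_gt0.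
Qed.

Lemma sweep_stdsimplex : stdsimplex (sweep b z).
Proof. by apply: normalize_stdsimplex => //; exact: sweep_sum. Qed.

Lemma supp_sweep : supp (sweep b z) \subset supp z.
Proof.
rewrite supp_normalize//; last exact: sweep_sum.
apply/fintype.subsetP => i; rewrite !inE -/w; apply: contraNN => /eqP zi.
rewrite eq_le sweep_ge0 andbT wE zi sub0r oppr_le0.
by rewrite mulr_ge0// bs.1.
Qed.

Lemma supp_sweep_neq : supp (sweep b z) != supp b.
Proof.
rewrite supp_normalize//; last exact: sweep_sum.
(* Since [c < 1], the minimum is not the default value 1. It is attained at some [i] in [supp b],
   and that coordinate is swept to 0. *)
have [i ib ci] : exists2 i, i \in supp b & z ord0 i / b ord0 i <= c.
  apply: contrapT => nex; have : c < c; last by rewrite ltxx.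
  rewrite {2}/c; apply/bigmin_gtP; split=> // i ib.
  by rewrite ltNge; apply/negP => ci; apply: nex; exists i.
apply/eqP => /setP/(_ i); rewrite ib inE -/w => /negP; apply.
rewrite eq_le sweep_ge0 andbT wE subr_le0.
by rewrite -ler_pdivrMr// b_gt0.
Qed.

End SweepLemmas.
End Sweep.

(** * Minimal complexes carrying a subordinate map *)

Section Metric.
Context {R : realType} {X : metricType R}.

Lemma near_mdist_lt (x : X) (e : R) : 0 < e -> \forall z \near x, mdist x z < e.
Proof.
move=> e0; have : nbhs x (ball x e) by exact: nbhsx_ballx.
by rewrite ballEmdist.
Qed.

Lemma mdist_continuous (c : X) : continuous (mdist c : X -> R).
Proof.
move=> x; apply/cvgrPdist_lt => e e0.
apply: filterS (near_mdist_lt x e0) => z xz.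
rewrite ltr_norml ltrBlDr addrC -ltrBlDr.
have := metric_triangle c x z; have := metric_triangle c z x.
rewrite (metric_sym z x); lra.
Qed.

Lemma near_mdistD (x : X) (e : R) : 0 < e ->
  \forall z \near x & d \near (0 : R)^'+,
    forall z', mdist z z' < d -> mdist x z' < e.
Proof.
move=> e0; near=> z d => z' /= zz'.
have : mdist x z < e / 2 by near: z; apply: near_mdist_lt; rewrite divr_gt0.
have : d < e / 2 by near: d; apply: nbhs_right_lt; rewrite divr_gt0.
have := metric_triangle x z z'; lra.
Unshelve. all: by end_near. Qed.

End Metric.

(** * Uniform estimates from compactness *)

Section CompactMetric.
Context {R : realType} {X : metricType R} (cX : compact [set: X]).

Lemma finite_ball_cover (r : R) : 0 < r ->
  exists (N : nat) (c : 'I_N -> X), forall x, exists i, mdist (c i) x < r.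
Proof.
move=> r0.
(* Finite lists of centers, filtered by inclusion: the near-covering form of compactness then yields
   one list that works for every point. *)
pose F := filter_from setT (fun s : seq X => [set s' : seq X | {subset s <= s'}]).
have FF : ProperFilter F.
  apply: filter_from_proper => [|s _]; last by exists s => /=.
  apply: filter_from_filter; first by exists [::].
  move=> s t _ _; exists (s ++ t) => // u /= stu; split => x xs;
    by apply: stu; rewrite mem_cat xs ?orbT.
have /compact_near_coveringP/(_ _ F (fun s x =>
    exists2 c, c \in s & mdist c x < r)) := cX.
have H x : [set: X] x -> \forall x' \near x & s \near F,
    exists2 c, c \in s & mdist c x' < r.
  move=> _; near=> z s => /=; exists x; last by near: z; exact: near_mdist_lt.
  by near: s; exists [:: x] => // s /= ; apply; rewrite inE.
move=> /(_ _ H) /filter_ex[s sP].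
exists (size s), (fun i => tnth (in_tuple s) i) => x.
have [c cs cx] := sP x I.
have /tnthP[i ci] : c \in in_tuple s by [].
by exists i; rewrite -ci.
Unshelve. all: by end_near. Qed.

Lemma uniform_modulus (V : normedModType R) (phi : X -> V) (e : R) :
  continuous phi -> 0 < e -> exists2 d : R, 0 < d &
    forall x z, mdist x z < d -> `|phi x - phi z| < e.
Proof.
move=> phic e0.
have /compact_near_coveringP/(_ _ 0^'+ (fun d x =>
   forall z, mdist x z < d -> `|phi x - phi z| < e)) := cX.
have H x : [set: X] x -> \forall x' \near x & d \near (0 : R)^'+,
    forall z, mdist x' z < d -> `|phi x' - phi z| < e.
  move=> _; have e20 : 0 < e / 2 by rewrite divr_gt0.
  have /cvgrPdist_lt/(_ _ e20)/nbhs_ballP[r /= r0] := phic x.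
  rewrite ballEmdist => rP.
  have xy : \forall y \near x & d \near (0 : R)^'+, mdist x y < r.
    by near=> y d => /=; near: y; exact: near_mdist_lt.
  apply: filterS2 xy (near_mdistD x r0) => -[y d] /= xy + z yz => /(_ z yz) xz.
  have := ler_distD (phi x) (phi y) (phi z).
  have : `|phi x - phi y| < e / 2 by exact: rP.
  have : `|phi x - phi z| < e / 2 by exact: rP.
  rewrite (distrC (phi y) (phi x)); lra.
move=> /(_ _ H) Hd.
near (0 : R)^'+ => d; exists d; first by near: d; exact: nbhs_right_gt.
by move=> x; move: (I : [set: X] x); move: x; near: d.
Unshelve. all: by end_near. Qed.

(** [D] is only continuous on a space that need not be compact, but the diagonal over [phi(X)] is
    compact. The points [p] and [q] may lie outside [phi(X)], as approximations of the chart do. *)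
Lemma uniform_near_diagonal (V : normedModType R) (phi : X -> V)
    (D : V * V -> R) (e : R) :
  continuous phi -> continuous D -> (forall v, D (v, v) = 0) -> 0 < e ->
  exists2 d : R, 0 < d & forall x p q,
    `|phi x - p| < d -> `|phi x - q| < d -> D (p, q) < e.
Proof.
move=> phic Dc D0 e0.
have /compact_near_coveringP/(_ _ 0^'+ (fun d x => forall p q,
    `|phi x - p| < d -> `|phi x - q| < d -> D (p, q) < e)) := cX.
have H x : [set: X] x -> \forall x' \near x & d \near (0 : R)^'+,
    forall p q, `|phi x' - p| < d -> `|phi x' - q| < d -> D (p, q) < e.
  move=> _.
  have /cvgrPdist_lt/(_ _ e0)/nbhs_ballP[r /= r0] := Dc (phi x, phi x).
  rewrite D0 => rP.
  have r20 : 0 < r / 2 by rewrite divr_gt0.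
  have /cvgrPdist_lt/(_ _ r20) xy := phic x.
  near=> y d => p q /= yp yq.
  have xy2 : `|phi x - phi y| < r / 2 by near: y.
  have dr : d < r / 2 by near: d; exact: nbhs_right_lt.
  have B v : `|phi y - v| < d -> ball (phi x) r v.
    rewrite -ball_normE /= => yv.
    have := ler_distD (phi y) (phi x) v; lra.
  have : `|0 - D (p, q)| < e by apply: rP; split; exact: B.
  by rewrite sub0r normrN; apply: le_lt_trans; exact: ler_norm.
move=> /(_ _ H) Hd.
near (0 : R)^'+ => d; exists d; first by near: d; exact: nbhs_right_gt.
by move=> x; move: (I : [set: X] x); move: x; near: d.
Unshelve. all: by end_near. Qed.

Lemma fixed_point_free_displacement (F : X -> X) :
  continuous F -> (forall x, F x <> x) ->
  exists2 e : R, 0 < e & forall x, e <= mdist x (F x).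
Proof.
move=> Fc Fx.
have /compact_near_coveringP/(_ _ 0^'+ (fun e x => e <= mdist x (F x))) := cX.
have H x : [set: X] x -> \forall x' \near x & e \near (0 : R)^'+,
    e <= mdist x' (F x').
  (* Moving [x] and [F x] by less than [r / 4] each leaves a displacement above [r / 2]. *)
  move=> _; set r := mdist x (F x).
  have r0 : 0 < r by rewrite mdist_gt0 eq_sym; apply/eqP/Fx.
  have r40 : 0 < r / 4 by rewrite divr_gt0.
  near=> y e => /=.
  have : mdist x y < r / 4 by near: y; exact: near_mdist_lt.
  have : mdist (F x) (F y) < r / 4.
    by near: y; exact: (Fc x _ (near_mdist_lt (F x) r40)).
  have : e < r / 2 by near: e; apply: nbhs_right_lt; rewrite divr_gt0.
  have := metric_triangle x y (F x).
  have := metric_triangle y (F y) (F x).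
  rewrite (metric_sym (F y) (F x)) -/r; lra.
move=> /(_ _ H) Hd.
near (0 : R)^'+ => d; exists d; first by near: d; exact: nbhs_right_gt.
by move=> x; move: (I : [set: X] x); move: x; near: d.
Unshelve. all: by end_near. Qed.

Section Carrier.
Context {N : nat} (c : 'I_N -> X) (r : R).
Implicit Types (L : {set {set 'I_N}}) (phi : X -> 'rV[R]_N).

Definition subordinate phi : Prop :=
  forall x i, phi x ord0 i != 0 -> mdist (c i) x < r.

Definition subordinate_map L phi : Prop :=
  [/\ continuous phi, forall x, realization L (phi x) & subordinate phi].

Lemma partition_of_unity : (forall x, exists i, mdist (c i) x < r) ->
  exists phi, subordinate_map [set s | s != finset.set0]%SET phi.
Proof.
move=> cov.
(* Tent functions supported in the balls; the covering hypothesis makes their sum positive. *)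
pose w x : 'rV[R]_N := \row_i Num.max (r - mdist (c i) x) 0.
have w0 x i : 0 <= w x ord0 i by rewrite mxE le_max lexx orbT.
have w1 x : 0 < \sum_i w x ord0 i.
  have [i ci] := cov x; rewrite (bigD1 i)//= ltr_pwDl ?sumr_ge0//.
  by rewrite mxE lt_max subr_gt0 ci.
exists (fun x => normalize (w x)); split.
- apply: continuous_normalize => [x|]; first by rewrite gt_eqF.
  apply: continuous_row => i; under eq_fun do rewrite mxE.
  apply: continuous_maxr; last exact: cst_continuous.
  by apply: continuous_subr; [exact: cst_continuous|exact: mdist_continuous].
- move=> x; have ws := normalize_stdsimplex (w0 x) (w1 x).
  by split=> //; rewrite inE supp_neq0.
- move=> x i; have : (i \in supp (normalize (w x))) = (i \in supp (w x)).
    by rewrite supp_normalize.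
  rewrite !inE => ->; rewrite mxE; apply: contraNT.
  by rewrite -leNgt -subr_le0 => /max_r ->.
Qed.

(** The missed point [y] is replaced by a missed point [b] in the open simplex of a maximal [tau]
    containing [supp y]. Sweeping from [b] only shrinks supports and never yields support [tau], and
    deleting a maximal simplex leaves a complex. *)
Lemma sweep_out L phi y : abstract_complex L -> subordinate_map L phi ->
  realization L y -> (forall x, phi x != y) ->
  exists (L' : {set {set 'I_N}}) psi,
    [/\ (#|L'| < #|L|)%N, abstract_complex L' & subordinate_map L' psi].
Proof.
move=> [L0 Ldown] [phic phiL phisub] [ys yL] phiy.
have [tau /maxsetP[tauL taumax] ytau] :=
  @maxset_exists _ (fun s => s \in L) _ yL.
(* The range of [phi] is compact, so a whole ball around [y] is missed. A short move from [y]
   towards the barycenter [m] of [tau] stays in this ball and gives full support in [tau]. *)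
have [b [bs btau phib]] : exists b : 'rV[R]_N,
    [/\ stdsimplex b, supp b = tau & forall x, phi x != b].
  pose m : 'rV[R]_N := normalize (\row_i (i \in tau)%:R).
  have m0 i : 0 <= (\row_i (i \in tau)%:R : 'rV[R]_N) ord0 i.
    by rewrite mxE ler0n.
  have m1 : 0 < \sum_i (\row_i (i \in tau)%:R : 'rV[R]_N) ord0 i.
    have /set0Pn[i itau] := L0 _ tauL.
    rewrite (bigD1 i)//= ltr_pwDl ?sumr_ge0//.
    by rewrite mxE itau ltr01.
  have ms : stdsimplex m := normalize_stdsimplex m0 m1.
  have mtau : supp m = tau.
    rewrite supp_normalize//; apply/setP => i; rewrite inE mxE.
    by case: (i \in tau); rewrite ?oner_eq0 ?eqxx.
  have /open_nbhs_nbhs : open_nbhs y (~` (range phi)).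
    split=> [|[x _ xy]]; last by move: (phiy x); rewrite xy eqxx.
    rewrite openC; apply: compact_closed; first exact: norm_hausdorff.
    by apply: continuous_compact => //; exact: continuous_subspaceT.
  move=> /nbhs_ballP[e /= e0 eP].
  (* A positive number below both [e] and 1. *)
  pose t := e / (1 + e).
  have t0 : 0 < t by rewrite divr_gt0// addr_gt0.
  have te : t < e by rewrite ltr_pdivrMr ?addr_gt0// mulrDr mulr1 ltrDl mulr_gt0.
  have t1 : t < 1 by rewrite ltr_pdivrMr ?addr_gt0// mul1r ltrDr.
  clearbody t; pose b : 'rV[R]_N := (1 - t) *: y + t *: m.
  have bE i : b ord0 i = (1 - t) * y ord0 i + t * m ord0 i by rewrite !mxE.
  have by0 i : 0 <= (1 - t) * y ord0 i by rewrite mulr_ge0 ?ys.1 ?subr_ge0 ?ltW.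
  have bm0 i : 0 <= t * m ord0 i by rewrite mulr_ge0 ?ms.1 ?ltW.
  exists b; split.
  - split=> [i|]; first by rewrite bE addr_ge0.
    under eq_bigr do rewrite bE.
    by rewrite big_split /= -!mulr_sumr ys.2 ms.2 !mulr1 subrK.
  - apply/setP => i; rewrite inE bE paddr_eq0// !mulf_eq0 (gt_eqF t0).
    rewrite subr_eq0 (gt_eqF t1) /=.
    have -> : (y ord0 i == 0) = (i \notin supp y) by rewrite inE negbK.
    have -> : (m ord0 i == 0) = (i \notin tau) by rewrite -mtau inE negbK.
    rewrite negb_and !negbK; case: (boolP (i \in supp y)) => //= iy.
    by apply/esym; move/fintype.subsetP : ytau; exact.
  - move=> x; apply/eqP => xb; have : (~` range phi) b; last by apply; exists x.
    apply: eP; split=> // j i; rewrite ord1 /ball /= bE.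
    have -> : y ord0 i - ((1 - t) * y ord0 i + t * m ord0 i) =
      t * (y ord0 i - m ord0 i) by ring.
    rewrite normrM (gtr0_norm t0) (le_lt_trans _ te)// -[leRHS]mulr1.
    apply: ler_wpM2l; first exact: ltW.
    have := ys.1 i; have := ms.1 i.
    have := stdsimplex_le1 i ys; have := stdsimplex_le1 i ms.
    by rewrite ler_norml => *; apply/andP; split; lra.
exists (L :\ tau), (fun x => sweep b (phi x)); split.
- by rewrite [ltnRHS](cardsD1 tau) tauL.
- split=> [s /setD1P[_ /L0]//|s t /setD1P[stau sL] ts t0].
  rewrite in_setD1 (Ldown _ _ sL ts t0) andbT.
  by apply: contraNneq stau => ttau; rewrite (taumax s)// -ttau.
- split=> [|x|x i].
  + apply: continuous_normalize => [x|].
      by rewrite gt_eqF// sweep_sum//; case: (phiL x).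
    apply: continuous_row => i; under eq_fun do rewrite !mxE.
    move=> x; apply: cvgB; first exact: continuous_coord.
    apply: cvgM; last exact: cvg_cst.
    exact: continuous_sweep_coef.
  + have [zs zL] := phiL x.
    have ss := sweep_stdsimplex bs zs (phib x).
    split=> //; rewrite in_setD1 -btau supp_sweep_neq//=.
    by apply: (Ldown _ _ zL); [exact: supp_sweep|exact: supp_neq0].
  + have [zs zL] := phiL x.
    move/fintype.subsetP : (supp_sweep bs zs (phib x)) => /(_ i).
    by rewrite !inE => /[apply]; exact: phisub.
Qed.

(** Induction on the number of simplices, starting from the full simplex: as long as some
    subordinate map is not onto, [sweep_out] provides a smaller complex. *)
Lemma essential_complex : (forall x, exists i, mdist (c i) x < r) ->
  exists L phi, [/\ abstract_complex L, subordinate_map L phi &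
    forall psi, subordinate_map L psi ->
      forall y, realization L y -> exists x, psi x = y].
Proof.
move=> /partition_of_unity[phi0 phi0P].
have : abstract_complex [set s : {set 'I_N} | s != finset.set0]%SET.
  by split=> [s|s t]; rewrite !inE.
move: phi0 phi0P; move: [set s | _]%SET => L.
have [n] := ubnP #|L|; elim: n L => // n IHn L Ln phi phiP LP.
have [ess|] := pselect (forall psi, subordinate_map L psi ->
  forall y, realization L y -> exists x, psi x = y); first by exists L, phi.
move=> /existsNP[psi] /not_implyP[psiP] /existsNP[y] /not_implyP[yL psiy].
have [|L' [psi' [L'L L'P psi'P]]] := sweep_out LP psiP yL.
  by move=> x; apply/eqP => xy; apply: psiy; exists x.
by apply: (IHn L' _ psi') => //; exact: leq_trans L'L _.
Qed.

End Carrier.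
End CompactMetric.

(** * Bonding maps *)

Section Shrink.
Context {R : realType} {N : nat}.
Implicit Types p q y : 'rV[R]_N.

Lemma coord_le_norm y i : `|y ord0 i| <= `|y|.
Proof.
by rewrite [leRHS]/Num.norm /= mx_normrE; apply: (le_bigmax _ _ (ord0, i)).
Qed.

Lemma norm_le_coord y e : 0 <= e -> (forall i, `|y ord0 i| <= e) -> `|y| <= e.
Proof.
move=> e0 ye; rewrite [leLHS]/Num.norm /= mx_normrE; apply/bigmax_leP; split=> //.
by move=> [j i] _; rewrite ord1.
Qed.

(** The lower bound [1/2] on the denominator is inactive on the standard simplex
    when [delta] is small; it makes [shrink] continuous everywhere. *)
Definition shrink_sum (delta : R) q : R := \sum_j Num.max (q ord0 j - delta) 0.

Definition shrink (delta : R) q : 'rV[R]_N :=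
  \row_i (Num.max (q ord0 i - delta) 0 / Num.max (shrink_sum delta q) (1 / 2)).

Lemma continuous_shrink delta : continuous (shrink delta).
Proof.
have maxc i : continuous (fun q : 'rV[R]_N => Num.max (q ord0 i - delta) 0).
  apply: continuous_maxr; last exact: cst_continuous.
  by apply: continuous_subr; [exact: coord_continuous|exact: cst_continuous].
apply: continuous_row => i; under eq_fun do rewrite mxE.
apply: continuous_mulr; first exact: maxc.
apply: continuous_invr => [q|].
  by rewrite gt_eqF// lt_max divr_gt0 ?orbT.
apply: continuous_maxr; last exact: cst_continuous.
by apply: continuous_sum => j; exact: maxc.
Qed.

Section ShrinkLemmas.
Variables (delta : R) (q : 'rV[R]_N).
Hypotheses (d0 : 0 < delta) (Nd : N%:R * delta <= 1 / 2) (qs : stdsimplex q).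
Let S := shrink_sum delta q.
Let a i := Num.max (q ord0 i - delta) 0.

Let a_ge0 i : 0 <= a i.
Proof. by rewrite le_max lexx orbT. Qed.

Let a_le i : a i <= q ord0 i.
Proof. by rewrite ge_max qs.1 andbT gerBl ltW. Qed.

Let a_ge i : q ord0 i - delta <= a i.
Proof. by rewrite le_max lexx. Qed.

Let S_le1 : S <= 1.
Proof. by rewrite -qs.2; apply: ler_sum => i _; exact: a_le. Qed.

Let S_ge : 1 - N%:R * delta <= S.
Proof.
apply: (@le_trans _ _ (\sum_j (q ord0 j - delta))); last first.
  by apply: ler_sum => i _; exact: a_ge.
by rewrite sumrB qs.2 sumr_const card_ord mulr_natl.
Qed.

Let S_gt0 : 0 < S.
Proof. by have := Nd; have := S_ge; lra. Qed.

Let shrinkE i : shrink delta q ord0 i = a i / S.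
Proof.
by rewrite mxE -/S [Num.max S _]max_l//; have := Nd; have := S_ge; lra.
Qed.

Lemma shrink_stdsimplex : stdsimplex (shrink delta q).
Proof.
split=> [i|]; first by rewrite shrinkE divr_ge0// ltW.
under eq_bigr do rewrite shrinkE.
by rewrite -mulr_suml divff// gt_eqF.
Qed.

(** This controls supports: if [q] is within [delta] of a point, any coordinate surviving in
    [shrink delta q] is nonzero at that point. *)
Lemma shrink_neq0 i : shrink delta q ord0 i != 0 -> delta < q ord0 i.
Proof.
rewrite shrinkE; apply: contraNT; rewrite -leNgt -subr_le0 => qd.
by rewrite /a max_r// mul0r.
Qed.

Lemma shrink_close i : `|shrink delta q ord0 i - q ord0 i| <= N.+1%:R * delta.
Proof.
have aS : a i <= S.
  rewrite /S /shrink_sum (bigD1 i)//= lerDl sumr_ge0// => j _; exact: a_ge0.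
have lo : a i <= a i / S by rewrite ler_pdivlMr// ler_piMr.
have hi : a i / S <= a i + N%:R * delta.
  have aS1 : a i / S <= 1 by rewrite ler_pdivrMr// mul1r.
  (* The cost of normalizing is [(a i / S) * (1 - S)], with first factor at most 1 and second at
     most [N * delta]. *)
  have -> : a i / S = a i + a i / S * (1 - S) by field; rewrite gt_eqF.
  rewrite lerD2l (@le_trans _ _ (1 - S))//; last by have := S_ge; lra.
  by rewrite ler_piMl// subr_ge0.
have Nd0 : 0 <= N%:R * delta by rewrite mulr_ge0// ltW.
rewrite shrinkE -natr1 mulrDl mul1r ler_norml; have := a_ge i; have := a_le i.
by move=> *; apply/andP; split; lra.
Qed.

End ShrinkLemmas.
End Shrink.

Section Interpolation.
Context {R : realType} {N M : nat} (v : 'I_M -> 'rV[R]_N).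

Definition interpolate (y : 'rV[R]_M) : 'rV[R]_N :=
  \row_i \sum_k y ord0 k * v k ord0 i.

Lemma continuous_interpolate : continuous interpolate.
Proof.
apply: continuous_row => i; under eq_fun do rewrite mxE.
apply: continuous_sum => k.
by apply: continuous_mulr; [exact: coord_continuous|exact: cst_continuous].
Qed.

Lemma interpolate_stdsimplex y : (forall k, stdsimplex (v k)) ->
  stdsimplex y -> stdsimplex (interpolate y).
Proof.
move=> vs ys; split=> [i|].
  by rewrite mxE sumr_ge0// => k _; rewrite mulr_ge0 ?ys.1 ?(vs k).1.
under eq_bigr do rewrite mxE.
rewrite exchange_big /= -[RHS]ys.2; apply: eq_bigr => k _.
by rewrite -mulr_sumr (vs k).2 mulr1.
Qed.

Lemma interpolate_close y p d : stdsimplex y ->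
  (forall k, y ord0 k != 0 -> `|v k - p| <= d) ->
  forall i, `|interpolate y ord0 i - p ord0 i| <= d.
Proof.
move=> ys vd i; rewrite mxE.
(* Writing [p] as the same convex combination of copies of itself leaves only the vertices in the
   support of [y] to compare. *)
have -> : p ord0 i = \sum_k y ord0 k * p ord0 i by rewrite -mulr_suml ys.2 mul1r.
rewrite -sumrB (le_trans (ler_norm_sum _ _ _))//.
rewrite -[leRHS]mul1r -ys.2 mulr_suml; apply: ler_sum => k _.
rewrite -mulrBr normrM (ger0_norm (ys.1 k)).
have [->|/vd vk] := eqVneq (y ord0 k) 0; first by rewrite !mul0r.
apply: ler_wpM2l; first exact: ys.1.
by apply: le_trans vk; have := coord_le_norm (v k - p) i; rewrite !mxE.
Qed.

End Interpolation.

(** * Stages of the expansion and the bonds between them *)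

Section Stages.
Context {R : realType} {X : metricType R}.

(** The gauge is a metric on the stage; it accumulates the distances between
    images in all previous stages. *)
Record stage := Stage {
  stage_dim : nat;
  site : 'I_stage_dim -> X;
  mesh : R;
  simplices : {set {set 'I_stage_dim}};
  chart : X -> 'rV[R]_stage_dim;
  gauge : 'rV[R]_stage_dim * 'rV[R]_stage_dim -> R;
  mesh_gt0 : 0 < mesh;
  simplicesP : abstract_complex simplices;
  chartP : subordinate_map site mesh simplices chart;
  chart_essential : forall psi, subordinate_map site mesh simplices psi ->
    forall y, realization simplices y -> exists x, psi x = y;
  gauge_continuous : continuous gauge;
  gauge_ge0 : forall p, 0 <= gauge p;
  gaugexx : forall v, gauge (v, v) = 0;
  gauge_eq0 : forall v w, gauge (v, w) = 0 -> v = w }.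

Arguments site : clear implicits.
Arguments gauge : clear implicits.

Definition polytope (S : stage) : set 'rV[R]_(stage_dim S) :=
  realization (simplices S).

Arguments polytope : clear implicits.

(** [bond_supp] makes preimages of a thread Cauchy, while [bond_gauge] and [bond_small] separate
    threads with distinct coordinates. The factor 13 leaves room for two distances of 6 meshes from
    chart preimages to a thread limit. *)
Record bonds (S S' : stage)
    (f : 'rV[R]_(stage_dim S') -> 'rV[R]_(stage_dim S)) : Prop :=
  Bonds {
    bond_continuous : continuous f;
    bond_polytope : forall y, polytope S' y -> polytope S (f y);
    bond_supp : forall x, supp (f (chart S' x)) \subset supp (chart S x);
    bond_mesh : mesh S' <= mesh S / 2;
    bond_gauge : forall v w, gauge S (f v, f w) <= gauge S' (v, w);
    bond_small : forall x z, mdist x z < 13 * mesh S' ->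
      gauge S (f (chart S' x), f (chart S' z)) < mesh S }.

Hypothesis cX : compact [set: X].

Lemma exists_chart (r : R) : 0 < r -> exists N (c : 'I_N -> X) L phi,
  [/\ abstract_complex L, subordinate_map c r L phi &
    forall psi, subordinate_map c r L psi ->
      forall y, realization L y -> exists x, psi x = y].
Proof.
move=> r0; have [N [c cov]] := finite_ball_cover cX r0.
by have [L [phi P]] := essential_complex cX cov; exists N, c, L, phi.
Qed.

Lemma exists_stage (e : R) : 0 < e -> exists S, mesh S = e.
Proof.
move=> e0; have [N [c [L [phi [LP phiP ess]]]]] := exists_chart e0.
pose g (p : 'rV[R]_N * 'rV[R]_N) := `|p.1 - p.2|.
have gc : continuous g.
  move=> p.
  apply: (@cvg_norm _ _ _ _ _ (fun p : 'rV[R]_N * 'rV[R]_N => p.1 - p.2)).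
  by apply: cvgB; [exact: cvg_fst|exact: cvg_snd].
have g0 p : 0 <= g p by exact: normr_ge0.
have gxx v : g (v, v) = 0 by rewrite /g /= subrr normr0.
have geq v w : g (v, w) = 0 -> v = w.
  by move=> /normr0_eq0/eqP; rewrite subr_eq0 => /eqP.
by exists (Stage e0 LP phiP ess gc g0 gxx geq).
Qed.

Lemma next_stage (S : stage) : exists S' f, @bonds S S' f.
Proof.
have [phic phiL phisub] := chartP S.
have phis x : stdsimplex (chart S x) by case: (phiL x).
pose N := stage_dim S.
have [eta eta0 etaP] := uniform_near_diagonal cX phic (@gauge_continuous S)
  (@gaugexx S) (mesh_gt0 S).
(* Interpolation costs [d], shrinking [(N + 1) * d], and passing from [z] to [x] in the chart
   another [d]: the total [(N + 3) * d] must stay below [eta]. Also [N * d <= 1 / 2] is required by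
   [shrink]. *)
pose d := Num.min eta (1 / 2) / (N%:R + 4).
have N0 : (0 : R) <= N%:R by rewrite ler0n.
have [d0 d1 d2] : [/\ 0 < d, (N%:R + 4) * d <= eta & (N%:R + 4) * d <= 1 / 2].
  have N4 : 0 < N%:R + 4 :> R by lra.
  have -> : (N%:R + 4) * d = Num.min eta (1 / 2).
    by rewrite /d mulrC divfK// gt_eqF.
  by rewrite !ge_min !lexx orbT; split=> //; rewrite divr_gt0// lt_min eta0; lra.
clearbody d.
have Nd : N%:R * d <= 1 / 2 by nra.
have [r1 r10 r1P] := uniform_modulus cX phic d0.
pose r := Num.min (mesh S / 2) (r1 / 13).
have r0 : 0 < r by rewrite lt_min !divr_gt0// mesh_gt0.
have rS : r <= mesh S / 2 by rewrite ge_min lexx.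
have rr1 : 13 * r <= r1 by rewrite mulrC -ler_pdivlMr// ge_min lexx orbT.
clearbody r.
have [M [c [L [phi [LP phiP ess]]]]] := exists_chart r0.
have [phi'c phi'L phi'sub] := phiP.
pose q := interpolate (fun k => chart S (c k)).
pose f y := shrink d (q y).
have fc : continuous f.
  move=> y; apply: continuous_comp; first exact: continuous_interpolate.
  exact: continuous_shrink.
have qs y : stdsimplex y -> stdsimplex (q y) by exact: interpolate_stdsimplex.
have qphi x i : `|q (phi x) ord0 i - chart S x ord0 i| <= d.
  apply: interpolate_close; first by case: (phi'L x).
  move=> k /phi'sub ck; apply/ltW/r1P; lra.
have fphi x i : `|f (phi x) ord0 i - chart S x ord0 i| <= (N%:R + 2) * d.
  have := ler_distD (q (phi x) ord0 i) (f (phi x) ord0 i) (chart S x ord0 i).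
  have := qphi x i.
  have := shrink_close d0 Nd (qs _ (phi'L x).1) i.
  rewrite -/(f _) -natr1; lra.
have fsupp x : supp (f (phi x)) \subset supp (chart S x).
  apply/fintype.subsetP => i; rewrite !inE.
  move=> /(shrink_neq0 Nd (qs _ (phi'L x).1)) dq.
  have := qphi x i; apply: contraTneq => ->; rewrite subr0 -ltNge.
  by apply: lt_le_trans dq _; exact: ler_norm.
have fs y : stdsimplex y -> stdsimplex (f y).
  by move=> /qs; exact: shrink_stdsimplex.
(* Essentiality of the new complex makes [phi] onto, so [y = phi x] and the support inclusion
   [fsupp] at [x] suffices. *)
have fL y : realization L y -> polytope S (f y).
  move=> yL; have [x <-] := ess _ phiP _ yL.
  have ffs := fs _ (phi'L x).1; split=> //.
  apply: ((simplicesP S).2 _ _ (phiL x).2); first exact: fsupp.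
  exact: supp_neq0.
have fsmall x z : mdist x z < 13 * r ->
    gauge S (f (phi x), f (phi z)) < mesh S.
  move=> xz; apply: (etaP x).
    apply: (@le_lt_trans _ _ ((N%:R + 2) * d)); last by nra.
    rewrite distrC; apply: norm_le_coord; first by nra.
    by move=> i; rewrite mxE [X in _ + X]mxE; exact: fphi.
  apply: (@le_lt_trans _ _ ((N%:R + 2) * d + d)); last by nra.
  apply: (le_trans (ler_distD (chart S z) _ _)); rewrite addrC lerD//; last first.
    apply/ltW/r1P; lra.
  rewrite distrC; apply: norm_le_coord; first by nra.
  by move=> i; rewrite mxE [X in _ + X]mxE; exact: fphi.
(* The norm term separates points; the pulled-back gauge makes [f] nonexpansive. *)
pose g (p : 'rV[R]_M * 'rV[R]_M) := `|p.1 - p.2| + gauge S (f p.1, f p.2).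
have ff : continuous (fun p : 'rV[R]_M * 'rV[R]_M => (f p.1, f p.2)).
  move=> p; apply: (@cvg_pair _ _ _ _ (nbhs (f p.1)) (nbhs (f p.2))).
    exact: (@continuous_comp _ _ _ fst f p cvg_fst (fc _)).
  exact: (@continuous_comp _ _ _ snd f p cvg_snd (fc _)).
have gc : continuous g.
  move=> p; apply: cvgD.
    apply: (@cvg_norm _ _ _ _ _ (fun p : 'rV[R]_M * 'rV[R]_M => p.1 - p.2)).
    by apply: cvgB; [exact: cvg_fst|exact: cvg_snd].
  exact: (@continuous_comp _ _ _ _ (gauge S) p (ff p) (@gauge_continuous S _)).
have g0 p : 0 <= g p by rewrite addr_ge0// gauge_ge0.
have gxx v : g (v, v) = 0 by rewrite /g /= subrr normr0 gaugexx addr0.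
have geq v w : g (v, w) = 0 -> v = w.
  move=> /eqP; rewrite paddr_eq0 ?gauge_ge0// normr_eq0 subr_eq0.
  by move=> /andP[/eqP].
exists (Stage r0 LP phiP ess gc g0 gxx geq), f; split=> //.
by move=> v w; rewrite /= /g /= lerDr.
Qed.

(** By [bond_supp], [f] after the chart of [S'] is again subordinate to the balls of [S], hence onto
    by essentiality. *)
Lemma bond_onto S S' f : @bonds S S' f ->
  forall y, polytope S y -> exists2 z, polytope S' z & f z = y.
Proof.
move=> fP y yS.
have [cc cL _] := chartP S'.
have [|x <-] := chart_essential (s := S) (psi := f \o chart S') _ yS; last first.
  by exists (chart S' x) => //; exact: cL.
split=> [x|x|x i /= fx].
- by apply: continuous_comp; [exact: cc|exact: bond_continuous fP _].
- exact/(bond_polytope fP)/cL.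
- have [_ _] := chartP S; apply.
  move/fintype.subsetP : (bond_supp fP x) => /(_ i).
  by rewrite !inE; exact.
Qed.

End Stages.

Arguments site {R X}.
Arguments gauge {R X}.
Arguments polytope {R X}.

(** * Inverse limits *)

Section Topology.

Lemma set_val_continuous (T : topologicalType) (A : set T) :
  continuous (set_val : A -> T).
Proof. exact: initial_continuous. Qed.

Lemma continuous_set_type (T U : topologicalType) (A : set U) (f : T -> A) :
  continuous (fun x => set_val (f x)) -> continuous f.
Proof. exact: continuous_comp_initial. Qed.

Lemma compact_set_type (T : topologicalType) (A : set T) :
  compact A -> compact [set: A].
Proof.
move=> cA F PF _.
have [|p [Ap pF]] := cA (set_val @ F) _.
  by apply: (@filterS _ F _ setT) => [y _|]; [exact: set_valP|exact: filterT].
exists (SigSub (mem_set Ap)); split=> // B C FB [U /= [[W oW <-]] /= Wp WC].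
have FB' : (set_val @ F) (set_val @` B).
  by apply: (@filterS _ F _ B) FB => z Bz; exists z.
have [_ [[z Bz <-] Wz]] := pF _ W FB' (open_nbhs_nbhs (conj oW Wp)).
by exists z; split=> //; exact: WC.
Qed.

Lemma closed_coincidence (T U : topologicalType) (f g : T -> U) :
  hausdorff_space U -> continuous f -> continuous g ->
  closed [set x | f x = g x].
Proof.
move=> hU fc gc p clp; apply: hU => A B Afp Bgp.
have [|z [/= fg [Az Bz]]] := clp (f @^-1` A `&` g @^-1` B).
  by apply: filterI; [exact: fc|exact: gc].
by exists (f z); split=> //; rewrite fg.
Qed.

Lemma continuous_compact_inverse (T U : topologicalType) (f : T -> U)
    (g : U -> T) :
  compact [set: T] -> hausdorff_space U -> continuous f ->
  cancel f g -> cancel g f -> continuous g.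
Proof.
move=> cT hU fc fg gf; apply/continuous_closedP => A clA.
have -> : g @^-1` A = f @` A.
  apply/seteqP; split=> [u Agu|_ [t At <-]]; last by rewrite /preimage /= fg.
  by exists (g u).
apply: compact_closed => //; apply: continuous_compact.
  exact: continuous_subspaceT.
exact: subclosed_compact clA cT _.
Qed.

End Topology.

Section InverseLimitProjection.
Context {P : nat -> topologicalType} {f : forall l, P l.+1 -> P l}.
Implicit Type x : inverse_limit f.

Lemma lim_proj_bond x n : lim_proj n x = f (lim_proj n.+1 x).
Proof. exact: (set_valP x). Qed.

Lemma bonding_lim_proj n m (le_nm : (n <= m)%N) x :
  bonding f le_nm (lim_proj m x) = lim_proj n x.
Proof.
elim: m le_nm => [|m IHm] le_nm.
  have n0 : n = 0%N by apply/eqP; rewrite -leqn0.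
  by move: le_nm; rewrite n0 => le_nm; rewrite bonding_refl.
have [le_nm'|] := leqP n m.
  by rewrite (bondingS _ le_nm') -lim_proj_bond IHm.
move=> lt_mn; have nm : n = m.+1 by apply/eqP; rewrite eqn_leq le_nm.
by move: le_nm; rewrite nm => le_nm; rewrite bonding_refl.
Qed.

Lemma lim_proj_continuous n : continuous (@lim_proj P f n).
Proof.
move=> x; apply: (@continuous_comp _ _ _ (@set_val _ (inverse_limit f))
  (fun z : prod_topology P => z n)); first exact: set_val_continuous.
exact: proj_continuous.
Qed.

Lemma lim_proj_surj (p0 : forall l, P l) :
  (forall l y, exists z, f z = y :> P l) ->
  forall n a, exists x, lim_proj n x = a.
Proof.
move=> fsurj n a.
(* Below [n] the family [b] is obtained by pushing [a] down; above [n] it keeps the arbitrary values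
   [p0]. *)
have [b bn bf] : exists2 b : forall l, P l, b n = a &
    forall l, (l < n)%N -> f (b l.+1) = b l.
  elim: n a => [|n IHn] a; first by exists (dfwith p0 0%N a); rewrite ?dfwithin.
  have [b bn bf] := IHn (f a); exists (dfwith b (n.+1) a).
      by rewrite dfwithin.
  move=> l; rewrite ltnS leq_eqVlt => /orP[/eqP ->|ln].
    by rewrite dfwithin dfwithout ?bn// eq_sym ltn_eqF.
  by rewrite !dfwithout ?bf// eq_sym ltn_eqF// ltnS// ltnW.
(* The thread follows [b] while [b] is compatible with the bonds, in particular up to level [n], and
   otherwise takes any preimage. *)
pose next l (y : P l) : P l.+1 :=
  if pselect (f (b l.+1) = y) then b l.+1 else projT1 (cid (fsurj l y)).
pose e : forall l, P l := nat_rect P (b 0%N) next.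
have nextP l y : f (next l y) = y.
  rewrite /next; case: (pselect (f (b l.+1) = y)) => // neq.
  exact: (projT2 (cid (fsurj l y))).
have eb l : (l <= n)%N -> e l = b l.
  elim: l => // l IHl ln; rewrite /= IHl; last exact: ltnW.
  by rewrite /next; case: (pselect (f (b l.+1) = b l)) => //; rewrite bf.
have eL : inverse_limit f (e : prod_topology P) by move=> l; rewrite /= nextP.
by exists (SigSub (mem_set eL)); exact: etrans (eb n (leqnn n)) bn.
Qed.

End InverseLimitProjection.

(** * The limit of a tower of stages is homeomorphic to the space *)

Section Tower.
Context {R : realType} {X : metricType R}.
Hypotheses (X0 : [set: X] !=set0) (cX : compact [set: X]).
Variable S : nat -> @stage R X.
Variable f : forall l, 'rV[R]_(stage_dim (S l.+1)) -> 'rV[R]_(stage_dim (S l)).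
Hypothesis fP : forall l, bonds (@f l).

Local Notation r l := (mesh (S l)).

Definition level l : topologicalType := set_type (polytope (S l)).

Definition level_bond l (y : level l.+1) : level l :=
  SigSub (mem_set (bond_polytope (fP l) (set_valP y))).

Lemma chart_polytope l x : polytope (S l) (chart (S l) x).
Proof. by have [_ + _] := chartP (S l); apply. Qed.

Definition level_chart l (x : X) : level l :=
  SigSub (mem_set (chart_polytope l x)).

Lemma level_bond_continuous l : continuous (@level_bond l).
Proof.
apply: continuous_set_type => y.
apply: (@continuous_comp _ _ _ (@set_val _ (polytope (S l.+1))) (@f l)).
  exact: set_val_continuous.
exact: bond_continuous (fP l) _.
Qed.

Lemma level_chart_continuous l : continuous (level_chart l).
Proof. by apply: continuous_set_type; case: (chartP (S l)). Qed.

Lemma chart_onto l y : polytope (S l) y -> exists x, chart (S l) x = y.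
Proof. by apply: chart_essential; exact: chartP. Qed.

Lemma level_chart_onto l (y : level l) : exists x, level_chart l x = y.
Proof.
have [x xy] := chart_onto (set_valP y).
by exists x; apply: val_inj.
Qed.

(** Each level thus inherits compactness and connectedness from [X]. *)
Lemma range_level_chart l : range (level_chart l) = [set: level l].
Proof.
apply/seteqP; split=> // y _; have [x <-] := level_chart_onto y.
by exists x.
Qed.

Lemma compact_level l : compact [set: level l].
Proof.
rewrite -range_level_chart; apply: continuous_compact => //.
by apply: continuous_subspaceT; exact: level_chart_continuous.
Qed.

Lemma connected_level l : connected [set: X] -> connected [set: level l].
Proof.
move=> cnX; rewrite -range_level_chart.
apply: connected_continuous_connected => //.
by apply: continuous_subspaceT; exact: level_chart_continuous.
Qed.

Lemma polyhedron_level l : polyhedron R (level l).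
Proof. by apply: polyhedron_realization; exact: simplicesP. Qed.

Lemma level_bond_onto l (y : level l) : exists z, level_bond z = y.
Proof.
have [z zS zy] := bond_onto (fP l) (set_valP y).
by exists (SigSub (mem_set zS)); apply: val_inj.
Qed.

(** Halving beats linear decay because [k + 2 <= 2 * (k + 1)]; the linear form fits the archimedean
    bound. *)
Lemma mesh_decay n k : r (n + k) * k.+1%:R <= r n.
Proof.
elim: k => [|k IHk]; first by rewrite addn0 mulr1.
apply: le_trans IHk; rewrite addnS.
have := bond_mesh (fP (n + k)); have := mesh_gt0 (S (n + k)).
have : (0 : R) <= k%:R by [].
rewrite -[k.+2%:R]natr1 -[k.+1%:R]natr1; nra.
Qed.

Lemma mesh_small n (e : R) : 0 < e -> exists k, r (n + k) < e.
Proof.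
move=> e0; exists (Num.bound (r n / e)).
have := archi_boundP (divr_ge0 (ltW (mesh_gt0 (S n))) (ltW e0)).
set k := Num.bound _; rewrite ltr_pdivrMr// => rk.
have k0 : (0 : R) < k.+1%:R by [].
have := mesh_decay n k; rewrite -ler_pdivlMr// => /le_lt_trans; apply.
by rewrite ltr_pdivrMr// mulrC (lt_le_trans rk)// ler_pM2r// ler_nat.
Qed.

Local Notation Y := (inverse_limit level_bond).

Definition coords l (y : Y) : 'rV[R]_(stage_dim (S l)) := set_val (lim_proj l y).

Lemma coords_polytope l y : polytope (S l) (coords l y).
Proof. exact: set_valP. Qed.

Lemma coords_bond l y : coords l y = f (coords l.+1 y).
Proof. by rewrite /coords lim_proj_bond. Qed.

Lemma coords_continuous l : continuous (coords l).
Proof.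
move=> y; apply: (@continuous_comp _ _ _ (@lim_proj level level_bond l)
  (@set_val _ (polytope (S l)))); first exact: lim_proj_continuous.
exact: set_val_continuous.
Qed.

Lemma coordsP y z : (forall l, coords l y = coords l z) -> y = z.
Proof.
move=> yz; apply/val_inj/functional_extensionality_dep => l.
exact/val_inj/yz.
Qed.

Lemma compact_limit : compact [set: Y].
Proof.
apply: compact_set_type; apply: (@subclosed_compact _ _ setT); last by [].
  (* The equations are stated in row vectors, whose Hausdorff property makes each coincidence set
     closed. *)
  rewrite (_ : inverse_limit _ = \bigcap_l [set x : prod_topology level |
    set_val (x l) = set_val (level_bond (x l.+1))]); last first.
    apply/seteqP; split=> [x xL l _|x xL l] /=; first by rewrite -xL.
    by apply: val_inj; exact: xL.
  have projc l : continuous (fun x : prod_topology level => x l).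
    exact: proj_continuous.
  apply: closed_bigI => l _; apply: closed_coincidence.
  - exact: norm_hausdorff.
  - by move=> x; apply: continuous_comp; [exact: projc|exact: set_val_continuous].
  - move=> x; apply: (@continuous_comp _ _ _
      (fun x : prod_topology level => x l.+1)
      (fun y => set_val (level_bond y))); first exact: projc.
    apply: continuous_comp; first exact: level_bond_continuous.
    exact: set_val_continuous.
have := @tychonoff nat level (fun=> setT) compact_level.
by congr compact; apply/seteqP.
Qed.

Lemma same_coord_dist l x z i :
  chart (S l) x ord0 i != 0 -> chart (S l) z ord0 i != 0 -> mdist x z < 2 * r l.
Proof.
have [_ _ sub] := chartP (S l) => /sub xi /sub zi.
have := metric_triangle x (site (S l) i) z.
rewrite (metric_sym x (site _ i)); lra.
Qed.

Lemma coords_neq0 l y : exists i, coords l y ord0 i != 0.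
Proof.
have /set0Pn[i] := supp_neq0 (coords_polytope l y).1.
by rewrite inE; exists i.
Qed.

(** A nonzero coordinate of the thread at level [l] is nonzero in the charts of both points: in that
    of [z] by [bond_supp]. *)
Lemma step_dist y l x z : chart (S l) x = coords l y ->
  chart (S l.+1) z = coords l.+1 y -> mdist x z < 2 * r l.
Proof.
move=> xy zy; have [i yi] := coords_neq0 l y.
apply: (@same_coord_dist _ _ _ i); first by rewrite xy.
move/fintype.subsetP: (bond_supp (fP l) z) => /(_ i).
by rewrite !inE; apply; rewrite zy -coords_bond.
Qed.

(** Induction through a point [w] over level [l + 1]: as meshes halve,
    [2 * r l + 4 * r (l + 1) <= 4 * r l]. *)
Lemma tail_dist y k l x z : chart (S l) x = coords l y ->
  chart (S (l + k)) z = coords (l + k) y -> mdist x z < 4 * r l.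
Proof.
elim: k l x => [|k IHk] l x xy.
  rewrite addn0 => zy; have [i yi] := coords_neq0 l y.
  have : mdist x z < 2 * r l.
    by apply: (@same_coord_dist _ _ _ i); rewrite ?xy ?zy.
  have := mesh_gt0 (S l); lra.
rewrite addnS -addSn => zy.
have [w wy] := chart_onto (coords_polytope l.+1 y).
have := step_dist xy wy; have := IHk _ _ wy zy.
have := bond_mesh (fP l); have := metric_triangle x w z; lra.
Qed.

Lemma exists_thread_limit y :
  exists p, forall l x, chart (S l) x = coords l y -> mdist x p < 6 * r l.
Proof.
have /choice[s sP] l := chart_onto (coords_polytope l y).
(* A cluster point of chosen preimages: the tail lies within 4 meshes of [x], and some tail point
   within one mesh of [p]. *)
have [p [_ pP]] := @cX (s @ \oo) _ filterT.
exists p => l x xy.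
have tail : (s @ \oo) [set z | mdist x z < 4 * r l].
  exists l => // m /= lm; move: (sP m); rewrite -(subnKC lm) => sm.
  exact: tail_dist xy sm.
have [z [/= xz pz]] := pP _ _ tail (near_mdist_lt p (mesh_gt0 (S l))).
have := metric_triangle x z p; rewrite (metric_sym z p).
have := mesh_gt0 (S l); lra.
Qed.

Definition thread_limit y : X := projT1 (cid (exists_thread_limit y)).

Lemma thread_limitP y l x :
  chart (S l) x = coords l y -> mdist x (thread_limit y) < 6 * r l.
Proof. exact: (projT2 (cid (exists_thread_limit y))). Qed.

Lemma thread_limit_continuous : continuous thread_limit.
Proof.
move=> y A /nbhs_ballP[e /= e0]; rewrite ballEmdist => eA.
(* 14 = 6 + 2 + 6: from each limit to its chart preimage, and between the preimages, which share the
   nonzero coordinate [i]. *)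
have [l] := @mesh_small 0 (e / 14) (divr_gt0 e0 (ltr0n _ 14)).
rewrite add0n => rl; have [i yi] := coords_neq0 l y.
have : \forall z \near y, coords l z ord0 i != 0.
  have cc : continuous (fun z : Y => coords l z ord0 i).
    by apply: continuous_coord; exact: coords_continuous.
  apply: (cc y [set u | u != 0]).
  by apply: open_nbhs_nbhs; split=> //; exact: open_neq.
apply: filterS => z zi; apply: eA => /=.
have [u uy] := chart_onto (coords_polytope l y).
have [v vz] := chart_onto (coords_polytope l z).
have : mdist u v < 2 * r l by apply: (@same_coord_dist _ _ _ i); rewrite ?uy ?vz.
have := thread_limitP uy; have := thread_limitP vz.
have := metric_triangle (thread_limit y) u (thread_limit z).
have := metric_triangle u v (thread_limit z).
rewrite (metric_sym (thread_limit y) u); lra.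
Qed.

Lemma gauge_le n k y z : gauge (S n) (coords n y, coords n z) <=
  gauge (S (n + k)) (coords (n + k) y, coords (n + k) z).
Proof.
elim: k => [|k IHk]; first by rewrite addn0.
apply: (le_trans IHk); rewrite addnS (coords_bond _ y) (coords_bond _ z).
exact: bond_gauge.
Qed.

(** With a common limit, preimages at level [n + k + 1] are within 12 meshes, so [bond_small] bounds
    the gauge at level [n + k] by [r (n + k)]. Gauges do not decrease along the tower, so the gauge
    at level [n] is arbitrarily small. *)
Lemma thread_limit_inj : injective thread_limit.
Proof.
move=> y z yz; apply: coordsP => n; apply: (@gauge_eq0 _ _ (S n)).
apply/eqP; rewrite eq_le gauge_ge0 andbT leNgt; apply/negP => g0.
have [k rk] := mesh_small n g0; move: rk; apply/negP; rewrite -leNgt.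
apply: (le_trans (gauge_le n k y z)).
rewrite (coords_bond _ y) (coords_bond _ z).
have [u uy] := chart_onto (coords_polytope (n + k).+1 y).
have [v vz] := chart_onto (coords_polytope (n + k).+1 z).
rewrite -uy -vz; apply/ltW/(bond_small (fP (n + k))).
have := thread_limitP uy; have := thread_limitP vz; rewrite yz.
have := metric_triangle u (thread_limit z) v.
rewrite (metric_sym (thread_limit z) v); have := mesh_gt0 (S (n + k).+1); lra.
Qed.

Lemma thread_limit_onto p : exists y, thread_limit y = p.
Proof.
have clr : closed (range thread_limit).
  apply: compact_closed; first exact: metric_hausdorff.
  apply: continuous_compact; last exact: compact_limit.
  by apply: continuous_subspaceT; exact: thread_limit_continuous.
suff : range thread_limit p by case=> y _ <-; exists y.
apply: clr => A /nbhs_ballP[e /= e0]; rewrite ballEmdist => eA.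
have [l] := @mesh_small 0 (e / 6) (divr_gt0 e0 (ltr0n _ 6)).
rewrite add0n => rl; have [x0 _] := X0.
(* The range is closed, so density is enough: a thread through the chart value of [p] at level [l]
   has its limit within [6 * r l] of [p]. *)
have [y yp] := lim_proj_surj (fun l => level_chart l x0) level_bond_onto
  (level_chart l p).
exists (thread_limit y); split; first by exists y.
apply: eA => /=; have : chart (S l) p = coords l y by rewrite /coords yp.
move/thread_limitP; lra.
Qed.

Lemma limit_homeomorphism : exists h : X -> Y,
  [/\ continuous h, cancel thread_limit h & cancel h thread_limit].
Proof.
have /choice[h hK] := thread_limit_onto.
have Kh : cancel thread_limit h by move=> y; apply: thread_limit_inj; rewrite hK.
exists h; split=> //.
apply: (continuous_compact_inverse compact_limit _ thread_limit_continuous Kh hK).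
exact: metric_hausdorff.
Qed.

End Tower.

Arguments thread_limit {R X} cX {S f} fP.

(** * Polyhedral expansion of a continuum and the equivalence *)

Section Expansion.
Context {R : realType} {X : metricType R}.

Lemma polyhedral_expansion (e : R) : continuum X -> 0 < e ->
  exists (P : nat -> topologicalType) (f : forall l, P l.+1 -> P l)
      (p : inverse_limit f -> X) (h : X -> inverse_limit f),
    [/\ forall l, polyhedron R (P l) /\ connected [set: P l],
        forall l, continuous (f l) /\ set_surj [set: P l.+1] [set: P l] (f l),
        [/\ continuous p, continuous h, cancel p h & cancel h p] &
        forall n y z, lim_proj n y = lim_proj n z -> mdist (p y) (p z) < e].
Proof.
move=> [X0 cnX cX] e0.
(* Threads agreeing at one level share a chart preimage, which is within 6 meshes of both limits; 12
   initial meshes make up [e]. *)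
have [S0 S0e] := exists_stage cX (divr_gt0 e0 (ltr0n R 12)).
pose next (S : @stage R X) := projT1 (cid (next_stage cX S)).
pose S l := iter l next S0.
have nextP (T : @stage R X) : exists f, @bonds R X T (next T) f.
  exact: projT2 (cid (next_stage cX T)).
pose f l : 'rV[R]_(stage_dim (S l.+1)) -> 'rV[R]_(stage_dim (S l)) :=
  projT1 (cid (nextP (S l))).
have fP l : bonds (@f l) by exact: projT2 (cid (nextP (S l))).
have [h [hc ph hp]] := limit_homeomorphism X0 cX fP.
exists (level S), (level_bond fP), (thread_limit cX fP), h; split.
- by move=> l; split; [exact: polyhedron_level|exact: connected_level].
- move=> l; split; first exact: level_bond_continuous.
  by move=> y _; have [z <-] := level_bond_onto fP y; exists z.
- by split=> //; exact: thread_limit_continuous.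
- move=> n y z yz.
  have [x xy] := chart_onto (coords_polytope n y).
  have := thread_limitP cX xy.
  have xz : chart (S n) x = coords n z by rewrite xy /coords yz.
  have := thread_limitP cX xz.
  have : mesh (S n) <= e / 12.
    rewrite -S0e -[leRHS]/(mesh (S 0)).
    have := mesh_decay fP 0 n; rewrite add0n; apply: le_trans.
    by rewrite ler_peMr ?(ltW (mesh_gt0 _))// ler1n.
  have := metric_triangle (thread_limit cX fP y) x (thread_limit cX fP z).
  rewrite (metric_sym _ x); lra.
Qed.

End Expansion.

Unset Implicit Arguments.

Theorem corollary3p8 (R : realType) (X : metricType R) (hX : continuum X)
    (n0 m0 : nat) (le_n0m0 : (n0 <= m0)%N) :
  ~ fixed_point_property X <->
  exists (P : nat -> topologicalType) (f : forall l : nat, P l.+1 -> P l),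
    [/\ forall l, polyhedron R (P l) /\ connected [set: P l],
        forall l, continuous (f l) /\ set_surj [set: P l.+1] [set: P l] (f l),
        homeomorphic (inverse_limit f) X &
        exists g : inverse_limit f -> inverse_limit f,
          continuous g /\
          forall x : P m0, ~ T_map n0 m0 g x (bonding f le_n0m0 x)].
Proof.
split=> [|[P [f [_ _ [p [h [pc hc ph hp]]] [g [gc gT]]]]] fpp].
  move=> /existsNP[F] /not_implyP[Fc] /forallNP Ffree.
  have [_ _ cX] := hX.
  have [e e0 eF] := fixed_point_free_displacement cX Fc Ffree.
  have [P [f [p [h [Ppoly fsurj [pc hc ph hp] small]]]]] :=
    polyhedral_expansion hX e0.
  exists P, f; split=> //; first by exists p, h.
  exists (fun y => h (F (p y))); split.
    move=> y; apply: (@continuous_comp _ _ _ p (fun x => h (F x))).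
      exact: pc.
    by apply: continuous_comp; [exact: Fc|exact: hc].
  (* Membership in [T_map] gives a thread [y] agreeing with its image at coordinate [n0], so [F]
     would move [p y] by less than [e]. *)
  move=> _ [_ [y <- <-]]; rewrite bonding_lim_proj => /esym/small.
  rewrite hp; apply/negP; rewrite -leNgt; exact: eF.
have [|x xfix] := fpp (fun x => p (g (h x))).
  move=> x; apply: (@continuous_comp _ _ _ h (fun y => p (g y))); first exact: hc.
  by apply: continuous_comp; [exact: gc|exact: pc].
have gh : g (h x) = h x by rewrite -[LHS]ph xfix.
(* The projection of the fixed thread [h x] to level [m0] violates the condition on [T_map]. *)
apply: (gT (lim_proj m0 (h x))); rewrite bonding_lim_proj.
by exists (h x) => //; exists (h x).
Qed.
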